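(* Let $\mathbb{K}$ be a field of characteristic $\neq 2$ and let $p,q\ge 0$. In $Cl(p+1,q+1)$ let $e,\tilde e$ be basis vectors with $e^2=1$, $\tilde e^2=-1$, let $Cl(p,q)\subset Cl(p+1,q+1)$ be the subalgebra generated by the remaining basis vectors, and put $P_\pm=\frac12(1\pm\tilde e e)$. Every $a\in Cl(p+1,q+1)$ can be written uniquely as $$a=P_+a_0^+ + P_+e\,a_1^+ + P_-a_0^- + P_-e\,a_1^-,\qquad a_0^\pm,a_1^\pm\in Cl(p,q),$$ and the map $$\Phi: Cl(p+1,q+1)\to M_2(Cl(p,q)),\qquad \Phi(a)=\begin{bmatrix} a_0^+ & \alpha(a_1^+)\\ a_1^- & \alpha(a_0^-)\end{bmatrix}$$ is an isomorphism of $\mathbb{K}$-algebras. Moreover, if $a=A_{00}+eA_{01}+\tilde eA_{10}+\tilde e e A_{11}$ with $A_{ij}\in Cl(p,q)$, then $$a_0^+=A_{00}+A_{11},\quad a_1^+=A_{01}+A_{10},\quad a_0^-=A_{00}-A_{11},\quad a_1^-=A_{01}-A_{10},$$ so that $$\Phi(a)=\begin{bmatrix} A_{00}+A_{11} & \alpha(A_{01}+A_{10})\\ A_{01}-A_{10} & \alpha(A_{00}-A_{11})\end{bmatrix},$$ and conversely $A_{00}=\frac12(a_0^++a_0^-)$, $A_{01}=\frac12(a_1^++a_1^-)$, $A_{10}=\frac12(a_1^+-a_1^-)$, $A_{11}=\frac12(a_0^+-a_0^-)$.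
   Context: $Cl(p,q)$ is the Clifford algebra over $\mathbb{K}$ generated by $p+q$ pairwise anticommuting basis vectors, $p$ of which square to $1$ and $q$ of which square to $-1$; it has dimension $2^{p+q}$, with basis the products (blades) of distinct basis vectors. $\alpha$ is the parity automorphism: the algebra automorphism sending every basis vector $v$ to $-v$. *)

(* Defs.v *)
From HB Require Import structures.
From mathcomp Require Import all_boot all_order all_algebra all_field.
Set Implicit Arguments.
Unset Strict Implicit.
Unset Printing Implicit Defensive.
Import GRing.Theory.
Local Open Scope ring_scope.

Section SymDiff.
Variable I : finType.
Implicit Types S T U : {set I}.

Definition symdiff S T : {set I} := [set k | (k \in S) (+) (k \in T)].

Lemma in_symdiff k S T : (k \in symdiff S T) = (k \in S) (+) (k \in T).
Proof. by rewrite inE. Qed.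

Lemma symdiffA : associative symdiff.
Proof. by move=> S T U; apply/setP=> k; rewrite !in_symdiff addbA. Qed.

Lemma symdiffC : commutative symdiff.
Proof. by move=> S T; apply/setP=> k; rewrite !in_symdiff addbC. Qed.

Lemma symdiff0 : right_id set0 symdiff.
Proof. by move=> S; apply/setP=> k; rewrite in_symdiff inE addbF. Qed.

Lemma sym0diff : left_id set0 symdiff.
Proof. by move=> S; rewrite symdiffC symdiff0. Qed.

Lemma symdiffS S : symdiff S S = set0.
Proof. by apply/setP=> k; rewrite in_symdiff inE addbb. Qed.

Lemma symdiff_setU1 k S : k \notin S -> symdiff [set k] S = k |: S.
Proof.
move=> kS; apply/setP=> l; rewrite in_symdiff !inE.
by case: eqP => [->|_] //=; rewrite (negPf kS).
Qed.

Lemma sum_symdiff (F : I -> bool) S T :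
  \big[addb/false]_(k in symdiff S T) F k =
  (\big[addb/false]_(k in S) F k) (+) (\big[addb/false]_(k in T) F k).
Proof.
rewrite !(big_mkcond (fun k => k \in _)) -big_split /=.
by apply: eq_bigr => k _; rewrite in_symdiff; case: (_ \in S) (_ \in T) (F k) => [] [] [].
Qed.

End SymDiff.

Section CliffordType.
Variables (K : fieldType) (I : finType) (neg : pred I).

(* The Clifford algebra over K with a basis vector for each element of I, which
   squares to -1 if it satisfies [neg] and to 1 otherwise.  An element is given
   by its coordinates on the basis of blades, a blade being the set of its
   factors; [blade_vec] and [dim_clifford] below check that blades are the
   ordered products of distinct basis vectors. *)
Definition clifford of pred I := {ffun {set I} -> K^o}.

Local Notation C := (clifford neg).

HB.instance Definition _ := Vector.copy C {ffun {set I} -> K^o}.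

(* The sign (-1) ^+ blade_odd S T of the product of two blades: sorting the
   factors of S followed by those of T takes one transposition for each pair
   k > l, and each repeated factor k = l is replaced by its square. *)
Definition blade_odd (S T : {set I}) : bool :=
  \big[addb/false]_(k in S) \big[addb/false]_(l in T)
     (((enum_rank l < enum_rank k)%N) || ((k == l) && neg k)).

Lemma blade_oddDl S T U :
  blade_odd (symdiff S T) U = blade_odd S U (+) blade_odd T U.
Proof. exact: sum_symdiff. Qed.

Lemma blade_oddDr S T U :
  blade_odd S (symdiff T U) = blade_odd S T (+) blade_odd S U.
Proof.
by rewrite /blade_odd -big_split; apply: eq_bigr => k _; rewrite sum_symdiff.
Qed.

Lemma blade_odd0l S : blade_odd set0 S = false.
Proof. by rewrite /blade_odd big_set0. Qed.

Lemma blade_odd0r S : blade_odd S set0 = false.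
Proof. by rewrite /blade_odd big1 // => k _; rewrite big_set0. Qed.

Lemma blade_odd11 k l :
  blade_odd [set k] [set l] =
  (enum_rank l < enum_rank k)%N || ((k == l) && neg k).
Proof. by rewrite /blade_odd !big_set1. Qed.

Definition blade (S : {set I}) : C := [ffun T => (T == S)%:R].

Definition clifford_mul (a b : C) : C :=
  [ffun U => \sum_(S : {set I})
     (-1) ^+ blade_odd S (symdiff S U) * a S * b (symdiff S U)].

Lemma symdiffK (S : {set I}) : involutive (symdiff S).
Proof. by move=> T; rewrite symdiffA symdiffS sym0diff. Qed.

Fact clifford_mulA : associative clifford_mul.
Proof.
move=> a b c; apply/ffunP=> U; rewrite !ffunE.
under eq_bigr => S _ do rewrite ffunE mulr_sumr.
under [RHS]eq_bigr => S _ do rewrite ffunE mulr_sumr mulr_suml.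
rewrite [RHS]exchange_big /=; apply: eq_bigr => S _.
rewrite [RHS](reindex_inj (inv_inj (symdiffK S))) /=; apply: eq_bigr => T _.
rewrite symdiffK; set W := symdiff T (symdiff S U).
have -> : symdiff (symdiff S T) U = W by rewrite (symdiffC S) -symdiffA.
have -> : symdiff S U = symdiff T W by rewrite symdiffK.
rewrite blade_oddDr blade_oddDl !signr_addb.
pose x : K := (-1) ^+ blade_odd S T; pose y : K := (-1) ^+ blade_odd S W.
pose z : K := (-1) ^+ blade_odd T W; pose aS : K := a S.
pose bT : K := b T; pose cW : K := c W.
rewrite -[LHS]/(x * y * aS * (z * bT * cW)) -[RHS]/(y * z * (x * aS * bT) * cW).
by rewrite [RHS](AC (2*3*1) ((3*1)*4*((2*5)*6))).
Qed.

Fact clifford_mul1l : left_id (blade set0) clifford_mul.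
Proof.
move=> a; apply/ffunP=> U; rewrite !ffunE (bigD1 set0) //= big1 => [|S neS0].
  by rewrite addr0 sym0diff blade_odd0l ffunE eqxx !mul1r.
by rewrite ffunE (negPf neS0) mulr0 mul0r.
Qed.

Fact clifford_mul1r : right_id (blade set0) clifford_mul.
Proof.
move=> a; apply/ffunP=> U; rewrite !ffunE (bigD1 U) //= big1 => [|S neSU].
  by rewrite addr0 symdiffS blade_odd0r ffunE eqxx mul1r mulr1.
rewrite ffunE; case: eqP => [dSU|]; last by rewrite mulr0.
by case/eqP: neSU; rewrite -[U](symdiffK S) dSU symdiff0.
Qed.

Fact clifford_mulDl : left_distributive clifford_mul +%R.
Proof.
move=> a b c; apply/ffunP=> U; rewrite !ffunE -big_split.
by apply: eq_bigr => S _; rewrite ffunE mulrDr mulrDl.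
Qed.

Fact clifford_mulDr : right_distributive clifford_mul +%R.
Proof.
move=> a b c; apply/ffunP=> U; rewrite !ffunE -big_split.
by apply: eq_bigr => S _; rewrite ffunE mulrDr.
Qed.

Fact clifford_oner_neq0 : blade set0 != 0.
Proof. by apply/eqP=> /ffunP/(_ set0)/eqP; rewrite !ffunE eqxx oner_eq0. Qed.

HB.instance Definition _ := GRing.Zmodule_isNzRing.Build C
  clifford_mulA clifford_mul1l clifford_mul1r clifford_mulDl clifford_mulDr
  clifford_oner_neq0.

Fact clifford_scalerAl (c : K) (a b : C) : c *: (a * b) = (c *: a) * b.
Proof.
apply/ffunP=> U; rewrite !ffunE scaler_sumr; apply: eq_bigr => S _.
by rewrite ffunE -[c *: a S]/(c * a S) -[LHS]/(c * (_ * _ * _)) mulrCA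
  [in RHS](mulrC c) !mulrA.
Qed.

HB.instance Definition _ := GRing.Lmodule_isLalgebra.Build K C clifford_scalerAl.

Fact clifford_scalerAr (c : K) (a b : C) : c *: (a * b) = a * (c *: b).
Proof.
apply/ffunP=> U; rewrite !ffunE scaler_sumr; apply: eq_bigr => S _.
by rewrite ffunE -[c *: b _]/(c * b _) -[LHS]/(c * (_ * _)) mulrCA.
Qed.

HB.instance Definition _ := GRing.Lalgebra_isAlgebra.Build K C clifford_scalerAr.
HB.instance Definition _ := Algebra_isFalgebra.Build K C.

Definition vec (k : I) : C := blade [set k].

Lemma coefB (S T : {set I}) : blade S T = (T == S)%:R.
Proof. by rewrite ffunE. Qed.

Lemma blade0 : blade set0 = 1. Proof. by []. Qed.

Lemma clifford_sum (a : C) : a = \sum_(S : {set I}) (a S : K) *: blade S.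
Proof.
apply/ffunP=> U; rewrite sum_ffunE (bigD1 U) //= big1 => [|S neSU].
  by rewrite addr0 ffunE coefB eqxx [RHS]mulr1.
by rewrite ffunE coefB eq_sym (negPf neSU) scaler0.
Qed.

Lemma dim_clifford : \dim {: C} = (2 ^ #|I|)%N.
Proof. by rewrite dimvf /dim /= -cardsT -powersetT card_powerset cardsT muln1. Qed.

Lemma bladeM (S T : {set I}) :
  blade S * blade T = (-1) ^+ blade_odd S T *: blade (symdiff S T).
Proof.
apply/ffunP=> U; rewrite !ffunE (bigD1 S) //= big1 => [|S' neS'].
  rewrite addr0 !ffunE eqxx mulr1.
  case: (U =P symdiff S T) => [->|neU]; first by rewrite symdiffK eqxx.
  case: eqP => [dT|_]; last by rewrite !(mulr0, scaler0).
  by case: neU; rewrite -dT symdiffK.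
by rewrite !ffunE (negPf neS') mulr0 mul0r.
Qed.

Lemma vec_sq k : vec k * vec k = (-1) ^+ neg k.
Proof.
by rewrite bladeM blade_odd11 ltnn eqxx symdiffS blade0 -signr_odd; case: (neg k);
   rewrite ?scale1r ?scaleN1r.
Qed.

Lemma vec_anticomm k l : k != l -> vec k * vec l = - (vec l * vec k).
Proof.
move=> nekl; rewrite !bladeM !blade_odd11 symdiffC [l == k]eq_sym (negPf nekl).
rewrite !orbF -scaleNr; have: enum_rank k != enum_rank l.
  by rewrite (inj_eq enum_rank_inj).
by rewrite -(inj_eq val_inj) neq_ltn => /orP[] lt; rewrite lt ltnNge ltnW ?opprK.
Qed.

End CliffordType.

Section Lift.
Variables (K : fieldType) (I : finType) (neg : pred I).

Lemma index_enum_rank (k : I) : index k (enum I) = enum_rank k.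
Proof.
rewrite -[X in index X](nth_enum_rank k) index_uniq ?enum_uniq //.
by rewrite -cardE.
Qed.

Lemma index_enum_sorted :
  pairwise (fun k l : I => enum_rank k < enum_rank l)%N (index_enum I).
Proof.
apply: (@sub_pairwise _ (relpre (index^~ (enum I)) ltn)) => [k l /=|].
  by rewrite !index_enum_rank.
rewrite [index_enum _]unlock -enumT -pairwise_map; suff -> : map (index^~ (enum I)) (enum I) =
  iota 0 (size (enum I)) by rewrite -sorted_pairwise ?iota_ltn_sorted //; exact: ltn_trans.
case: (enum I) (enum_uniq I) => // x0 s Us.
apply: (@eq_from_nth _ 0%N) => [|n]; rewrite size_map ?size_iota // => ltn.
by rewrite (nth_map x0) // index_uniq // nth_iota.
Qed.

Definition clifford_rel (A : algType K) (f : I -> A) :=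
  (forall k, f k * f k = (-1) ^+ neg k) /\
  (forall k l, k != l -> f k * f l = - (f l * f k)).

(* When [clifford_rel f], this is the unique algebra morphism sending each
   basis vector [vec k] to [f k]; see [clifford_lift_is_monoid_morphism] and
   [clifford_lift_uniq]. *)
Definition clifford_lift (A : algType K) (f : I -> A) (a : clifford K neg) : A :=
  \sum_(S : {set I}) (a S : K) *: \prod_(k in S) f k.

Section Rel.
Variables (A : algType K) (f : I -> A).

Fact clifford_lift_is_linear : linear (clifford_lift f).
Proof.
move=> c a b; rewrite scaler_sumr -big_split; apply: eq_bigr => S _ /=.
by rewrite !ffunE scalerDl scalerA.
Qed.

Lemma clifford_lift_blade S : clifford_lift f (blade K neg S) = \prod_(k in S) f k.
Proof.
rewrite /clifford_lift (bigD1 S) //= [X in _ + X]big1 => [|T neTS].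
  by rewrite addr0 coefB eqxx scale1r.
by rewrite coefB (negPf neTS) scale0r.
Qed.

Lemma clifford_lift_vec k : clifford_lift f (vec K neg k) = f k.
Proof. by rewrite clifford_lift_blade big_set1. Qed.

Hypothesis fP : clifford_rel f.

Lemma vec_prod (r : seq I) (k : I) (T : {set I}) :
    pairwise (fun k l : I => enum_rank k < enum_rank l)%N r -> k \in r ->
  f k * \prod_(l <- r | l \in T) f l =
  (-1) ^+ (\big[addb/false]_(l <- r | l \in T)
             ((enum_rank l < enum_rank k)%N || ((k == l) && neg k))) *:
  \prod_(l <- r | l \in symdiff [set k] T) f l.
Proof.
have [f2 fN] := fP; elim: r => // l r IHr /= /andP[lr rr]; rewrite !big_cons in_symdiff !inE.
case: (k =P l) => [kl _|/eqP nekl /= kr]; first subst l.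
  have gtk m : m \in r -> (enum_rank m < enum_rank k)%N = false /\ (k == m) = false.
    move=> /(allP lr) ltm; split; first by rewrite ltnNge ltnW.
    by apply: contraTF ltm => /eqP->; rewrite ltnn.
  have -> : \big[addb/false]_(l <- r | l \in T)
             ((enum_rank l < enum_rank k)%N || ((k == l) && neg k)) = false.
    by rewrite big_seq_cond big1 // => m /andP[/gtk[-> ->]].
  have -> : \prod_(l <- r | l \in symdiff [set k] T) f l = \prod_(l <- r | l \in T) f l.
    rewrite big_seq_cond [RHS]big_seq_cond; apply: eq_bigl => m.
    case mr: (m \in r) => //=; rewrite in_symdiff !inE eq_sym.
    by have [_ ->] := gtk m mr.
  rewrite ltnn eqxx addbF; case: (k \in T) => /=; last by rewrite scale1r.
  by rewrite mulrA f2; case: (neg k); rewrite ?scale1r ?mul1r // scaleN1r mulN1r.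
rewrite [l == k]eq_sym (negPf nekl) orbF /=.
have -> : (enum_rank l < enum_rank k)%N by exact: (allP lr).
case: (l \in T); last exact: IHr.
by rewrite mulrA fN // mulNr -mulrA IHr // signr_addb expr1 mulN1r scaleNr -scalerAr.
Qed.

Lemma blade_prod (S T : {set I}) :
  (\prod_(k in S) f k) * (\prod_(l in T) f l) =
  (-1) ^+ blade_odd neg S T *: \prod_(k in symdiff S T) f k.
Proof.
pose P (U : {set I}) := \prod_(k in U) f k.
have fkP k U : f k * P U = (-1) ^+ blade_odd neg [set k] U *: P (symdiff [set k] U).
  by rewrite /P vec_prod ?index_enum_sorted ?mem_index_enum // /blade_odd big_set1.
pose cut (r : seq I) := [set k in r | k \in S].
suff prodP (r : seq I) : pairwise (fun k l : I => enum_rank k < enum_rank l)%N r ->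
    (\prod_(k <- r | k \in S) f k) * P T =
    (-1) ^+ blade_odd neg (cut r) T *: P (symdiff (cut r) T).
  have := prodP (index_enum I) index_enum_sorted; congr (_ = _ ^+ blade_odd _ _ _ *: P (symdiff _ _));
  by apply/setP=> k; rewrite inE mem_index_enum.
elim: r => [_|k r IHr /= /andP[kr rr]].
  have -> : cut [::] = set0 by apply/setP=> k; rewrite !inE.
  by rewrite big_nil mul1r blade_odd0l sym0diff scale1r.
rewrite big_cons; case: ifPn => kS; last first.
  rewrite IHr //; congr (_ ^+ blade_odd _ _ _ *: P (symdiff _ _));
  apply/setP=> l; rewrite !inE; case: eqP => [->|//]; by rewrite (negPf kS) !andbF.
have kr0 : k \notin cut r.
  by rewrite inE negb_and; apply/orP; left; apply/negP=> /(allP kr); rewrite ltnn.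
have -> : cut (k :: r) = symdiff [set k] (cut r).
  rewrite symdiff_setU1 //; apply/setP=> l; rewrite !inE.
  by case: eqP => [->|//]; rewrite kS.
have kcut : blade_odd neg [set k] (cut r) = false.
  rewrite /blade_odd big_set1 big1 // => l; rewrite inE => /andP[/(allP kr) ltl _].
  rewrite ltnNge ltnW //=; apply/andP=> -[/eqP dl _].
  by rewrite dl ltnn in ltl.
rewrite -mulrA IHr // -scalerAr fkP scalerA -signr_addb blade_oddDl blade_oddDr.
by rewrite kcut addFb addbC symdiffA.
Qed.

Fact clifford_lift_is_monoid_morphism : monoid_morphism (clifford_lift f).
Proof.
pose L : {linear _ -> _} := HB.pack (clifford_lift f)
  (GRing.isLinear.Build _ _ _ _ (clifford_lift f) clifford_lift_is_linear).
split=> [|a b]; first by rewrite -blade0 clifford_lift_blade big_set0.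
transitivity (L ((\sum_(S : {set I}) (a S : K) *: blade K neg S) *
                 (\sum_(S : {set I}) (b S : K) *: blade K neg S))).
  by rewrite -!clifford_sum.
rewrite mulr_suml linear_sum mulr_suml; apply: eq_bigr => S _.
rewrite mulr_sumr linear_sum mulr_sumr; apply: eq_bigr => T _.
rewrite -!scalerAl -!scalerAr !linearZ bladeM linearZ /=.
rewrite clifford_lift_blade blade_prod.
by rewrite [LHS]scalerA [RHS]scalerA [X in X *: _]mulrC.
Qed.

End Rel.

Lemma blade_vec (S : {set I}) : blade K neg S = \prod_(k in S) vec K neg k.
Proof.
pose cut (r : seq I) := [set k in r | k \in S].
suff cutP (r : seq I) : pairwise (fun k l : I => enum_rank k < enum_rank l)%N r ->
    blade K neg (cut r) = \prod_(k <- r | k \in S) vec K neg k.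
  rewrite -cutP ?index_enum_sorted //; congr blade.
  by apply/setP=> k; rewrite inE mem_index_enum.
elim: r => [_|k r IHr /= /andP[kr rr]].
  by rewrite big_nil -blade0; congr blade; apply/setP=> k; rewrite !inE.
rewrite big_cons; case: ifPn => kS; last first.
  rewrite -IHr //; congr blade; apply/setP=> l; rewrite !inE.
  by case: eqP => [->|//]; rewrite (negPf kS) !andbF.
have kr0 : k \notin cut r.
  by rewrite inE negb_and; apply/orP; left; apply/negP=> /(allP kr); rewrite ltnn.
rewrite -IHr // bladeM; have -> : blade_odd neg [set k] (cut r) = false.
  rewrite /blade_odd big_set1 big1 // => l; rewrite inE => /andP[/(allP kr) ltl _].
  rewrite ltnNge ltnW //=; apply/andP=> -[/eqP dl _].
  by rewrite dl ltnn in ltl.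
rewrite scale1r symdiff_setU1 //; congr blade; apply/setP=> l; rewrite !inE.
by case: eqP => [->|//]; rewrite kS.
Qed.

Lemma clifford_lift_uniq (A : algType K) (f : I -> A)
    (h : {lrmorphism clifford K neg -> A}) :
  (forall k, h (vec K neg k) = f k) -> h =1 clifford_lift f.
Proof.
move=> hf a; rewrite {1}[a]clifford_sum linear_sum; apply: eq_bigr => S _ /=.
rewrite linearZ /= blade_vec rmorph_prod; congr (_ *: _).
by apply: eq_bigr => k _; exact: hf.
Qed.

Lemma clifford_gen :
  fullv = agenv <<[seq vec K neg k | k <- enum I]>>%VS.
Proof.
apply/eqP; rewrite eqEsubv subvf andbT; apply/subvP=> a _.
rewrite [a]clifford_sum; apply: rpred_sum => S _; apply: rpredZ.
rewrite blade_vec; elim/big_rec: _ => [|k b _ gb].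
  exact: (subvP (sub1_agenv _) _ (memv_line _)).
rewrite -agenvM memv_mul // (subvP (sub_agenv _)) // memv_span //.
by apply: map_f; rewrite mem_enum.
Qed.

End Lift.

Arguments blade {K I neg} S.
Arguments vec {K I neg} k.

Section Parity.
Variables (K : fieldType) (I : finType) (neg : pred I).

Definition parity : clifford K neg -> clifford K neg :=
  clifford_lift (fun k => - vec k).

Fact parity_rel : clifford_rel neg (fun k : I => - (vec k : clifford K neg)).
Proof.
by split=> [k|k l nekl]; rewrite !mulrNN; [exact: vec_sq | exact: vec_anticomm].
Qed.

HB.instance Definition _ :=
  GRing.isLinear.Build K (clifford K neg) (clifford K neg) _ parity
    (clifford_lift_is_linear _).
HB.instance Definition _ :=
  GRing.isMonoidMorphism.Build (clifford K neg) (clifford K neg) parity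
    (clifford_lift_is_monoid_morphism parity_rel).

Lemma parity_vec k : parity (vec k) = - vec k.
Proof. exact: clifford_lift_vec. Qed.

Lemma parityK : involutive parity.
Proof.
move=> a; pose V : {lrmorphism clifford K neg -> clifford K neg} := idfun.
pose P : {lrmorphism clifford K neg -> clifford K neg} := parity \o parity.
rewrite -[LHS]/(P a) -[RHS]/(V a) !(@clifford_lift_uniq _ _ _ _ vec) // => k.
by rewrite /= parity_vec linearN /= parity_vec opprK.
Qed.

End Parity.

Arguments parity {K I neg}.

Section Relabel.
Variables (K : fieldType) (I J : finType) (neg : pred I) (neg' : pred J).
Variable g : I -> J.
Hypotheses (g_inj : injective g) (g_neg : forall k, neg' (g k) = neg k).

Fact relabel_rel : clifford_rel neg (fun k => vec (g k) : clifford K neg').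
Proof.
split=> [k|k l nekl]; first by rewrite vec_sq g_neg.
by rewrite vec_anticomm // inj_eq.
Qed.

Lemma relabel_inj :
  injective (clifford_lift (fun k => vec (g k)) : clifford K neg -> clifford K neg').
Proof.
set f : I -> clifford K neg' := fun k => vec (g k).
have prodE (S : {set I}) : exists s : bool,
    \prod_(k in S) f k = (-1) ^+ s *: blade (g @: S).
  pose cut (r : seq I) := [set k in r | k \in S].
  suff cutP (r : seq I) : uniq r -> exists s : bool,
      \prod_(k <- r | k \in S) f k = (-1) ^+ s *: blade (g @: cut r).
    have [s ds] := cutP _ (index_enum_uniq I); exists s; rewrite {}ds.
    have -> // : cut (index_enum I) = S.
    by apply/setP=> k; rewrite inE mem_index_enum.
  elim: r => [_|k r IHr /= /andP[kr /IHr[s ds]]].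
    exists false; rewrite big_nil scale1r -blade0; congr blade.
    have -> : cut [::] = set0 by apply/setP=> k; rewrite !inE.
    by rewrite imset0.
  rewrite big_cons; case: ifPn => kS; last first.
    exists s; rewrite ds; have -> // : cut (k :: r) = cut r.
    apply/setP=> l; rewrite !inE.
    by case: eqP => [->|//]; rewrite (negPf kS) !andbF.
  exists (s (+) blade_odd neg' [set g k] (g @: cut r)).
  have -> : cut (k :: r) = k |: cut r.
    by apply/setP=> l; rewrite !inE; case: eqP => [->|//]; rewrite kS.
  rewrite ds -scalerAr bladeM scalerA signr_addb symdiff_setU1 ?imsetU1 //.
  by rewrite mem_imset // inE negb_and kr.
pose L : {linear clifford K neg -> clifford K neg'} := HB.pack (clifford_lift f)
  (GRing.isLinear.Build _ _ _ _ (clifford_lift f) (clifford_lift_is_linear f)).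
apply: (raddf_inj (f := L)) => a La0; apply/ffunP=> S; rewrite ffunE.
have [s ds] := prodE S; move/ffunP/(_ (g @: S)): La0.
rewrite /= /clifford_lift sum_ffunE ffunE (bigD1 S) //= [X in _ + X]big1 => [|T neTS].
  rewrite addr0 ds !ffunE eqxx => /eqP; rewrite scaler_eq0 => /orP[/eqP //|].
  by rewrite -[_ *: _]/(_ * _) mulr1 signr_eq0.
have [t ->] := prodE T; rewrite !ffunE (inj_eq (imset_inj g_inj)).
by rewrite eq_sym (negPf neTS) !scaler0.
Qed.

End Relabel.

(* In Cl(p,q) the basis vectors [inl _] square to 1, the [inr _] to -1. *)
Definition Cl_neg {p q : nat} (k : 'I_p + 'I_q) : bool :=
  if k is inr _ then true else false.

Notation Cl K p q := (clifford K (@Cl_neg p q)).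

Section Inclusion.
Variables (K : fieldType) (p q : nat) (i : 'I_p.+1) (j : 'I_q.+1).

(* The basis vectors of Cl(p+1,q+1) distinct from [inl i] and [inr j] *)
Definition other (k : 'I_p + 'I_q) : 'I_p.+1 + 'I_q.+1 :=
  match k with inl m => inl (lift i m) | inr n => inr (lift j n) end.

Lemma other_inj : injective other.
Proof. by case=> m [] n // [e]; congr (_ _); apply/val_inj/(can_inj (bumpK _))/e. Qed.

Lemma other_neg k : Cl_neg (other k) = Cl_neg k.
Proof. by case: k. Qed.

Lemma codom_other k : (k \in codom other) = (k != inl i) && (k != inr j).
Proof.
apply/codomP/andP => [[[] m ->] /=|[]].
- by split; rewrite // (inj_eq (@inl_inj _ _)) eq_sym neq_lift.
- by split; rewrite // (inj_eq (@inr_inj _ _)) eq_sym neq_lift.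
case: k => m.
  rewrite (inj_eq (@inl_inj _ _)) eq_sym => nei _.
  by have [n -> _] := unlift_some nei; exists (inl n).
rewrite (inj_eq (@inr_inj _ _)) [m == j]eq_sym => _ nej.
by have [n -> _] := unlift_some nej; exists (inr n).
Qed.

(* Cl(p,q) as a subalgebra of Cl(p+1,q+1): an injective algebra morphism
   ([Cl_incl_inj]) whose image is the subalgebra generated by the basis vectors
   other than [inl i] and [inr j] ([limg_Cl_incl]). *)
Definition Cl_incl : Cl K p q -> Cl K p.+1 q.+1 :=
  clifford_lift (fun k => vec (other k)).

HB.instance Definition _ :=
  GRing.isLinear.Build K (Cl K p q) (Cl K p.+1 q.+1) _ Cl_incl
    (clifford_lift_is_linear _).
HB.instance Definition _ :=
  GRing.isMonoidMorphism.Build (Cl K p q) (Cl K p.+1 q.+1) Cl_incl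
    (clifford_lift_is_monoid_morphism (relabel_rel K other_inj other_neg)).

Lemma Cl_incl_vec k : Cl_incl (vec k) = vec (other k).
Proof. exact: clifford_lift_vec. Qed.

Lemma Cl_incl_inj : injective Cl_incl.
Proof. exact: relabel_inj other_inj. Qed.

Lemma limg_Cl_incl :
  limg (linfun Cl_incl) =
  agenv <<[seq (vec k : Cl K p.+1 q.+1) | k : 'I_p.+1 + 'I_q.+1 <- enum predT
            & (k != inl i) && (k != inr j)]>>%VS.
Proof.
rewrite clifford_gen -[linfun Cl_incl]/(ahval (linfun_ahom Cl_incl)) aimg_agen limg_span.
rewrite -map_comp; congr agenv; apply: eq_span => a.
apply/mapP/mapP => [[k _ ->]|[k]].
  exists (other k); last by rewrite /= lfunE /= Cl_incl_vec.
  by rewrite mem_filter mem_enum -codom_other codom_f.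
rewrite mem_filter mem_enum -codom_other andbT => /codomP[l ->] ->.
by exists l; rewrite ?mem_enum //= lfunE /= Cl_incl_vec.
Qed.

End Inclusion.

Arguments Cl_incl {K p q} i j.

Definition mx2 (R : Type) (a b c d : R) : 'M[R]_2 :=
  \matrix_(r, s) if r == ord0 then if s == ord0 then a else b
                 else if s == ord0 then c else d.

(* Square matrices over A are in the library a module over A but not over K;
   the action of K through its image in A is the entrywise one. *)
Lemma in_alg_scalemxE (K : fieldType) (A : algType K) n (c : K) (M : 'M[A]_n) :
  (GRing.in_alg A \; *:%R) c M = map_mx ( *:%R c) M.
Proof. by apply/matrixP=> r s; rewrite !mxE mulr_algl. Qed.

(* Main.v *)
From HB Require Import structures.
Require Import Defs.
From mathcomp Require Import all_boot all_order all_algebra all_field.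
Set Implicit Arguments.
Unset Strict Implicit.
Unset Printing Implicit Defensive.
Import GRing.Theory.
Local Open Scope ring_scope.

(* The elements u11 = P+, u12 = P+ e, u21 = P- e, u22 = P- are matrix units of
   Cl(p+1,q+1), and they commute with D x = P+ x + P- alpha(x), a ring morphism
   on Cl(p,q).  Hence M |-> sum_rs u_rs D(M_rs) is a ring morphism, and it sends
   the matrix Phi is required to take at P+ a0p + P+ e a1p + P- a0m + P- e a1m
   back to that element; Phi is its inverse.  Bijectivity comes from that of
   (A00, A01, A10, A11) |-> A00 + e A01 + et A10 + et e A11: the image contains
   1 and is stable under left multiplication by basis vectors, so it is all of
   Cl(p+1,q+1), and injectivity follows by comparing dimensions. *)

(** * Ring morphisms out of matrix rings, from matrix units *)

Section MatrixUnits.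
Variables (A B : nzRingType) (n : nat) (D : {rmorphism A -> B}) (u : 'I_n.+1 -> 'I_n.+1 -> B).
Hypotheses (uM : forall r s t v, u r s * u t v = if s == t then u r v else 0)
           (u1 : \sum_r u r r = 1) (uD : forall r s x, GRing.comm (u r s) (D x)).

(** In the product of two such sums, [D (M r s)] moves past [u t v]; the factor [u r s * u t v] then
    keeps only the terms with [s = t], which is matrix multiplication. *)
Lemma matrix_units_monoid_morphism :
  monoid_morphism (fun M : 'M[A]_n.+1 => \sum_r \sum_s u r s * D (M r s)).
Proof.
split=> [|M N].
  rewrite -u1; apply: eq_bigr => r _; rewrite (bigD1 r) //= big1 => [|s nesr].
    by rewrite addr0 mxE eqxx rmorph1 mulr1.
  by rewrite mxE eq_sym (negPf nesr) rmorph0 mulr0.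
rewrite mulr_suml; apply: eq_bigr => r _; rewrite [RHS]mulr_suml.
under eq_bigr => t _ do rewrite mxE rmorph_sum mulr_sumr.
rewrite exchange_big; apply: eq_bigr => s _ /=.
rewrite mulr_sumr [RHS](bigD1 s) //= [X in _ + X]big1 => [|s' ness'].
  rewrite addr0 mulr_sumr; apply: eq_bigr => t _.
  by rewrite rmorphM !mulrA -(mulrA (u r s)) -uD mulrA uM eqxx.
rewrite mulr_sumr big1 // => t _.
by rewrite -mulrA (mulrA (D _)) -uD !mulrA uM eq_sym (negPf ness') !mul0r.
Qed.

End MatrixUnits.

(** * Sums, two-by-two matrices and linear bijections *)

Lemma big_ord2 (V : nmodType) (F : 'I_2 -> V) : \sum_r F r = F ord0 + F ord_max.
Proof. by rewrite big_ord_recl big_ord1; congr (_ + F _); apply: val_inj. Qed.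

Lemma addrACA4 (V : nmodType) (x1 y1 x2 y2 x3 y3 x4 y4 : V) :
  x1 + y1 + (x2 + y2) + (x3 + y3) + (x4 + y4) =
  x1 + x2 + x3 + x4 + (y1 + y2 + y3 + y4).
Proof. by rewrite (addrACA x1) (addrACA (x1 + x2)) (addrACA (x1 + x2 + x3)). Qed.

Lemma mx2_eta (R : Type) (M : 'M[R]_2) :
  mx2 (M ord0 ord0) (M ord0 ord_max) (M ord_max ord0) (M ord_max ord_max) = M.
Proof.
by apply/matrixP=> [[[|[|r]] ltr]] [[|[|s]] lts] //; rewrite !mxE /=; congr (M _ _); apply: val_inj.
Qed.

Lemma linear_surj_bij (K : fieldType) (U V : vectType K) (f : {linear U -> V}) :
  (forall v, exists u, v = f u) -> dim U = dim V -> bijective f.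
Proof.
move=> f_surj dimUV; have surj : limg (linfun f) = fullv.
  apply/eqP; rewrite eqEsubv subvf; apply/subvP=> v _.
  by have [u ->] := f_surj v; rewrite -(lfunE f) memv_img ?memvf.
have ker0 : lker (linfun f) == 0%VS.
  have /eqP := limg_ker_dim (linfun f) fullv.
  by rewrite capfv surj !dimvf dimUV -[X in _ == X]add0n eqn_add2r dimv_eq0.
exists (linfun f)^-1%VF => [u|v]; first by rewrite -(lfunE f) lker0_lfunK.
by rewrite -(lfunE f) limg_lfunVK // surj memvf.
Qed.

(** * Peirce decomposition in an abstract algebra with anticommuting [e] and [et] *)

Section PeirceDecomposition.
Variables (K : fieldType) (C C' : algType K).
Variables (iota : {lrmorphism C -> C'}) (alpha : {lrmorphism C -> C}) (e et : C').
Hypotheses (alphaK : involutive alpha).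
Hypotheses (e_sq : e * e = 1) (et_sq : et * et = -1) (e_et : e * et = - (et * e)).
Hypotheses (e_iota : forall x, e * iota x = iota (alpha x) * e)
           (et_iota : forall x, et * iota x = iota (alpha x) * et).

Definition multivector (x : C * C * C * C) : C' :=
  iota x.1.1.1 + e * iota x.1.1.2 + et * iota x.1.2 + et * e * iota x.2.

Fact multivector_is_linear : linear multivector.
Proof.
move=> c [[[a b] d] f] [[[a' b'] d'] f'].
rewrite /multivector /= !linearP /= !mulrDr -!scalerAr !scalerDr.
exact: addrACA4.
Qed.

HB.instance Definition _ :=
  GRing.isLinear.Build K (C * C * C * C)%type C' _ multivector multivector_is_linear.

(** This and the next two lemmas serve to show that the image of [multivector] is stable under left
    multiplication by each basis vector. *)
Lemma mul_e_multivector (a b c d : C') :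
  e * (a + e * b + et * c + et * e * d) = b + e * a + et * - d + et * e * - c.
Proof.
rewrite !mulrDr !mulrN !mulrA e_sq e_et !mulNr -(mulrA et e e) e_sq mul1r mulr1.
by rewrite [LHS](ACl (2*1*4*3)).
Qed.

Lemma mul_et_multivector (a b c d : C') :
  et * (a + e * b + et * c + et * e * d) = - c + e * - d + et * a + et * e * b.
Proof.
rewrite !mulrDr !mulrN !mulrA et_sq !mulNr !mul1r.
by rewrite [LHS](ACl (3*4*1*2)).
Qed.

Lemma mul_anticomm_multivector (v a b c d : C') :
    e * v = - (v * e) -> et * v = - (v * et) ->
  v * (a + e * b + et * c + et * e * d) =
  v * a + e * - (v * b) + et * - (v * c) + et * e * (v * d).
Proof.
move=> ev etv; rewrite !mulrDr !mulrN !mulrA ev etv -(mulrA et e v) ev mulrN mulrA etv.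
by rewrite !mulNr !opprK.
Qed.

Lemma e_et_e : e * et * e = - et. Proof. by rewrite e_et mulNr -mulrA e_sq mulr1. Qed.

Hypothesis charK : 2%N \notin [pchar K].
Hypothesis multivector_bij : bijective multivector.

Lemma two_neq0 : 2 != 0 :> K.
Proof. by apply: contraNneq charK => two0; rewrite inE /= two0 eqxx. Qed.

Lemma halfK (V : lmodType K) (x y : V) : 2^-1 *: (x + y) + 2^-1 *: (x - y) = x.
Proof.
by rewrite -scalerDr addrACA subrr addr0 -mulr2n -scaler_nat scalerA mulVf ?two_neq0 ?scale1r.
Qed.

Lemma halfKN (V : lmodType K) (x y : V) : 2^-1 *: (x + y) - 2^-1 *: (x - y) = y.
Proof. by rewrite -scalerN opprB [x + y]addrC halfK. Qed.

Definition Pplus : C' := 2^-1 *: (1 + et * e).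
Definition Pminus : C' := 2^-1 *: (1 - et * e).

Definition peirce (x : C * C * C * C) : C' :=
  Pplus * iota x.1.1.1 + Pplus * e * iota x.1.1.2 + Pminus * iota x.1.2 + Pminus * e * iota x.2.

(** As [et * e * e = et], the elements [Pplus * e] and [Pminus * e] are the halves of [e + et] and
    [e - et]. *)
Lemma peirceE a0p a1p a0m a1m :
  peirce (a0p, a1p, a0m, a1m) =
  multivector (2^-1 *: (a0p + a0m), 2^-1 *: (a1p + a1m),
               2^-1 *: (a1p - a1m), 2^-1 *: (a0p - a0m)).
Proof.
rewrite /peirce /multivector /Pplus /Pminus /= !linearZ /=.
rewrite -!scalerAl -!scalerAr -!scalerDr; congr (_ *: _).
rewrite !linearB !linearD !(mulrDr, mulrDl, mulNr, mulrN) !mul1r -(mulrA et e e) e_sq mulr1 !addrA.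
by rewrite [LHS](ACl (1*5*3*7*4*8*2*6)).
Qed.

Lemma multivectorE A00 A01 A10 A11 :
  multivector (A00, A01, A10, A11) = peirce (A00 + A11, A01 + A10, A00 - A11, A01 - A10).
Proof.
have hD (x y : C) : 2^-1 *: (x + y + (x - y)) = x by rewrite scalerDr halfK.
have hB (x y : C) : 2^-1 *: (x + y - (x - y)) = y by rewrite scalerBr halfKN.
by rewrite peirceE !hD !hB.
Qed.

(** [peirce] is [multivector] after an invertible change of coordinates, whose inverse is [h]. *)
Lemma peirce_bij : bijective peirce.
Proof.
have [g gK Kg] := multivector_bij.
pose h (x : C * C * C * C) :=
  (x.1.1.1 + x.2, x.1.1.2 + x.1.2, x.1.1.1 - x.2, x.1.1.2 - x.1.2).
exists (h \o g) => [[[[a b] c] d]|a] /=.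
  by rewrite peirceE gK /h /= !halfK !halfKN.
by rewrite -[RHS]Kg; case: (g a) => [[[A B] D] E]; rewrite multivectorE.
Qed.

(** * The orthogonal idempotents and their commutation rules *)

Lemma PplusDPminus : Pplus + Pminus = 1. Proof. exact: halfK. Qed.

(** With w = [et * e], this makes (1 + w)(1 - w) vanish, whence orthogonality; idempotence follows
    since the two idempotents sum to 1. *)
Lemma ete_sq : et * e * (et * e) = 1.
Proof. by rewrite -mulrA (mulrA e) e_et_e mulrN et_sq opprK. Qed.

Lemma PplusPminus : Pplus * Pminus = 0.
Proof.
by rewrite -scalerAl -scalerAr mulrDl mul1r mulrBr mulr1 ete_sq addrC subrKA subrr !scaler0.
Qed.

Lemma PminusPplus : Pminus * Pplus = 0.
Proof.
by rewrite -scalerAl -scalerAr mulrBl mul1r mulrDr mulr1 ete_sq [1 + _]addrC subrr !scaler0.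
Qed.

Lemma PplusPplus : Pplus * Pplus = Pplus.
Proof. by rewrite -[RHS]mulr1 -PplusDPminus mulrDr PplusPminus addr0. Qed.

Lemma PminusPminus : Pminus * Pminus = Pminus.
Proof. by rewrite -[RHS]mulr1 -PplusDPminus mulrDr PminusPplus add0r. Qed.

(** [e] anticommutes with [et * e], so it exchanges the two idempotents. *)
Lemma ePplus : e * Pplus = Pminus * e.
Proof.
by rewrite -scalerAl -scalerAr mulrDr mulrBl mulr1 mul1r mulrA e_et_e -mulrA e_sq mulr1.
Qed.

Lemma ePminus : e * Pminus = Pplus * e.
Proof.
by rewrite -scalerAl -scalerAr mulrBr mulrDl mulr1 mul1r mulrA e_et_e opprK -mulrA e_sq mulr1.
Qed.

(** Passing [e] and then [et] applies [alpha] twice, which is the identity. *)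
Lemma ete_comm_iota x : GRing.comm (iota x) (et * e).
Proof. by rewrite /GRing.comm -(mulrA et) e_iota (mulrA et) et_iota alphaK mulrA. Qed.

Lemma Pplus_comm_iota x : GRing.comm Pplus (iota x).
Proof.
rewrite /GRing.comm -scalerAl -scalerAr; congr (_ *: _).
exact/commr_sym/commrD/ete_comm_iota/commr1.
Qed.

Lemma Pminus_comm_iota x : GRing.comm Pminus (iota x).
Proof.
rewrite /GRing.comm -scalerAl -scalerAr; congr (_ *: _).
exact/commr_sym/commrB/ete_comm_iota/commr1.
Qed.

(* The diagonal embedding of C into the 2 x 2 matrices over C which commutes with
   the matrix units below: the twist by alpha compensates e x = alpha x e. *)
Definition twisted_diag (x : C) : C' := Pplus * iota x + Pminus * iota (alpha x).

Fact twisted_diag_is_linear : linear twisted_diag.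
Proof.
move=> c x y; rewrite /twisted_diag !linearP /= !mulrDr -!scalerAr scalerDr.
by rewrite addrACA.
Qed.

Lemma Pplus_comm_twisted_diag x : GRing.comm Pplus (twisted_diag x).
Proof.
apply: commrD; apply: commrM; try exact: Pplus_comm_iota; first by [].
by rewrite /GRing.comm PplusPminus PminusPplus.
Qed.

Lemma Pminus_comm_twisted_diag x : GRing.comm Pminus (twisted_diag x).
Proof.
apply: commrD; apply: commrM; try exact: Pminus_comm_iota; last by [].
by rewrite /GRing.comm PplusPminus PminusPplus.
Qed.

(** Moving [e] across exchanges the idempotents and applies [alpha], so the two summands of
    [twisted_diag x] trade places. *)
Lemma e_comm_twisted_diag x : GRing.comm e (twisted_diag x).
Proof.
rewrite /GRing.comm mulrDr mulrDl !mulrA ePplus ePminus -!mulrA !e_iota alphaK.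
by rewrite addrC.
Qed.

Lemma Pplus_twisted_diag x : Pplus * twisted_diag x = Pplus * iota x.
Proof. by rewrite mulrDr !mulrA PplusPplus PplusPminus mul0r addr0. Qed.

Lemma Pminus_twisted_diag x : Pminus * twisted_diag x = Pminus * iota (alpha x).
Proof. by rewrite mulrDr !mulrA PminusPminus PminusPplus mul0r add0r. Qed.

Fact twisted_diag_is_monoid_morphism : monoid_morphism twisted_diag.
Proof.
split=> [|x y]; first by rewrite /twisted_diag !rmorph1 !mulr1 PplusDPminus.
rewrite {2}/twisted_diag mulrDl Pplus_comm_iota Pminus_comm_iota.
rewrite -!mulrA Pplus_twisted_diag Pminus_twisted_diag /twisted_diag !rmorphM /= !mulrA.
by rewrite Pplus_comm_iota Pminus_comm_iota.
Qed.

HB.instance Definition _ := GRing.isLinear.Build K C C' _ twisted_diag twisted_diag_is_linear.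
HB.instance Definition _ :=
  GRing.isMonoidMorphism.Build C C' twisted_diag twisted_diag_is_monoid_morphism.

(** * The matrix units and the inverse of Phi *)

Definition matrix_unit (r s : 'I_2) : C' :=
  (if r == ord0 then Pplus else Pminus) * (if r == s then 1 else e).

(** Since [e] exchanges the idempotents, [matrix_unit r s] absorbs on its right the idempotent of
    index [s]; orthogonality kills the product when [s] and [t] differ, and [e * e = 1] settles the
    rest. *)
Lemma matrix_unit_mul r s t v :
  matrix_unit r s * matrix_unit t v = if s == t then matrix_unit r v else 0.
Proof.
have meP z : z * e * Pplus = z * Pminus * e by rewrite -mulrA ePplus mulrA.
have meM z : z * e * Pminus = z * Pplus * e by rewrite -mulrA ePminus mulrA.
have mee z : z * e * e = z by rewrite -mulrA e_sq mulr1.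
case: r s t v => [[|[|r]] ltr] // [[|[|s]] lts] // [[|[|t]] ltt] // [[|[|v]] ltv] //;
rewrite /matrix_unit /= ?mulr1 ?mulrA ?(meP, meM);
by rewrite ?(PplusPplus, PminusPminus, PplusPminus, PminusPplus) ?mul0r ?mee.
Qed.

Lemma matrix_unit_sum : \sum_r matrix_unit r r = 1.
Proof. by rewrite big_ord2 /matrix_unit /= !mulr1 PplusDPminus. Qed.

Lemma matrix_unit_comm r s x : GRing.comm (matrix_unit r s) (twisted_diag x).
Proof.
apply/commr_sym/commrM; apply/commr_sym.
  by case: ifP => _; [exact: Pplus_comm_twisted_diag | exact: Pminus_comm_twisted_diag].
by case: ifP => _; [exact/commr_sym/commr1 | exact: e_comm_twisted_diag].
Qed.

Definition of_matrix (M : 'M[C]_2) : C' :=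
  \sum_r \sum_s matrix_unit r s * twisted_diag (M r s).

Fact of_matrix_is_monoid_morphism : monoid_morphism of_matrix.
Proof.
exact: matrix_units_monoid_morphism matrix_unit_mul matrix_unit_sum matrix_unit_comm.
Qed.

(** Read through the inverse bijection, this is the linearity required of Phi. *)
Lemma of_matrix_linear c M N :
  of_matrix ((GRing.in_alg C \; *:%R) c M + N) = c *: of_matrix M + of_matrix N.
Proof.
rewrite in_alg_scalemxE /of_matrix scaler_sumr -big_split; apply: eq_bigr => r _.
rewrite scaler_sumr -big_split; apply: eq_bigr => s _ /=.
by rewrite !mxE linearP mulrDr -scalerAr.
Qed.

(** Row [Pminus] contributes one [alpha] through [twisted_diag], and each off-diagonal [e] another.
    The total is even in the first column and odd in the second, where the [alpha] in the entries
    cancels it. *)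
Lemma of_matrixE a0p a1p a0m a1m :
  of_matrix (mx2 a0p (alpha a1p) a1m (alpha a0m)) = peirce (a0p, a1p, a0m, a1m).
Proof.
rewrite /of_matrix !big_ord2 /matrix_unit !mxE /= !mulr1 -!mulrA !e_comm_twisted_diag !mulrA.
rewrite !Pplus_twisted_diag !Pminus_twisted_diag !alphaK -!mulrA -!e_iota.
by rewrite [_ * (_ * iota a1m) + _]addrC /peirce /= !mulrA addrA.
Qed.

Lemma of_matrix_bij : bijective of_matrix.
Proof.
have [g gK Kg] := peirce_bij.
exists (fun a => let: (a0p, a1p, a0m, a1m) := g a in
  mx2 a0p (alpha a1p) a1m (alpha a0m)) => [M|a].
  rewrite -[M in LHS]mx2_eta -[M ord0 ord_max]alphaK -[M ord_max ord_max]alphaK.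
  by rewrite of_matrixE gK !alphaK mx2_eta.
by rewrite -[RHS]Kg; case: (g a) => [[[a0p a1p] a0m] a1m]; rewrite of_matrixE.
Qed.

End PeirceDecomposition.

(** Blades span and are products of basis vectors, so each is reached from 1 by left
    multiplications. *)
Lemma clifford_ind (K : fieldType) (I : finType) (neg : pred I)
    (P : clifford K neg -> Prop) :
  P 1 -> (forall k a, P a -> P (vec k * a)) ->
  (forall c a b, P a -> P b -> P (c *: a + b)) -> forall a, P a.
Proof.
(* The empty linear combination is obtained as [-1 *: 1 + 1]. *)
move=> P1 PM PL a; have P0 : P 0 by rewrite -[0](addNr 1) -scaleN1r; apply: PL.
rewrite [a]clifford_sum; elim/big_rec: _ => // S b _; apply: PL.
by rewrite blade_vec; elim/big_rec: _ => // k b' _; apply: PM.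
Qed.

(** * The relations and the bijectivity of [multivector] in Clifford algebras *)

Section Decomposition.
Variables (K : fieldType) (p q : nat) (i : 'I_p.+1) (j : 'I_q.+1).
Local Notation C := (Cl K p q).
Local Notation C' := (Cl K p.+1 q.+1).
Local Notation e := (vec (inl i) : C').
Local Notation et := (vec (inr j) : C').
Local Notation multivector := (multivector (Cl_incl i j) e et).
Local Notation iota := (Cl_incl i j : C -> C').

Lemma e_sq : e * e = 1. Proof. by rewrite vec_sq. Qed.

Lemma et_sq : et * et = -1. Proof. by rewrite vec_sq expr1. Qed.

Lemma e_et : e * et = - (et * e). Proof. exact: vec_anticomm. Qed.

Lemma e_other k : e * vec (other i j k) = - (vec (other i j k) * e).
Proof.
apply: vec_anticomm; have := codom_f (other i j) k; rewrite codom_other eq_sym.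
by case/andP.
Qed.

Lemma et_other k : et * vec (other i j k) = - (vec (other i j k) * et).
Proof.
apply: vec_anticomm; have := codom_f (other i j) k; rewrite codom_other eq_sym andbC eq_sym.
by case/andP.
Qed.

(** By induction on [x]: a further factor [vec k] yields one sign on the left by anticommutation and
    one on the right by [parity]. *)
Lemma anticomm_Cl_incl (w : C') :
  (forall k, w * vec (other i j k) = - (vec (other i j k) * w)) ->
  forall x, w * iota x = iota (parity x) * w.
Proof.
move=> wN; elim/clifford_ind => [|k a IHa|c a b IHa IHb].
- by rewrite !rmorph1 mul1r mulr1.
- by rewrite !rmorphM /= parity_vec linearN /= Cl_incl_vec mulrA wN !mulNr -!mulrA IHa.
- by rewrite !linearP /= mulrDr mulrDl -scalerAr -scalerAl IHa IHb.
Qed.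

Definition e_Cl_incl := anticomm_Cl_incl e_other.
Definition et_Cl_incl := anticomm_Cl_incl et_other.

Lemma multivector_surj (a : C') : exists x, a = multivector x.
Proof.
elim/clifford_ind: a => [|k _ [[[[a b] c] d] ->]|c _ _ [x ->] [y ->]].
- by exists (1, 0, 0, 0); rewrite /multivector /= rmorph1 !rmorph0 !mulr0 !addr0.
- case ek: (k == inl i); last case ej: (k == inr j).
  + exists (b, a, -d, -c); rewrite (eqP ek) /multivector /= !(linearN (Cl_incl i j)) /=.
    exact: mul_e_multivector e_sq e_et _ _ _ _.
  + exists (-c, -d, a, b); rewrite (eqP ej) /multivector /= !(linearN (Cl_incl i j)) /=.
    exact: mul_et_multivector et_sq _ _ _ _.
  + have /codomP[l ->] : k \in codom (other i j) by rewrite codom_other ek ej.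
    exists (vec l * a, - (vec l * b), - (vec l * c), vec l * d).
    rewrite /multivector /= !(linearN (Cl_incl i j)) !(rmorphM (Cl_incl i j)) /= Cl_incl_vec.
    exact: mul_anticomm_multivector (e_other l) (et_other l).
- by exists (c *: x + y); rewrite linearP.
Qed.

(** Surjectivity suffices, as four copies of a space of dimension 2 ^ (p + q) have dimension 2 ^ (p
    + q + 2). *)
Lemma multivector_bij : bijective multivector.
Proof.
have dimC n m : dim (Cl K n m) = (2 ^ (n + m))%N.
  by rewrite -dimvf dim_clifford card_sum !card_ord.
apply: linear_surj_bij multivector_surj _.
rewrite -[LHS]/(dim C + dim C + dim C + dim C)%N !dimC addnS addSn !expnS.
by rewrite !mul2n -!addnn !addnA.
Qed.

End Decomposition.

Theorem mainTheorem1 (K : fieldType) (charK : 2%N \notin [pchar K]) (p q : nat)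
    (i : 'I_p.+1) (j : 'I_q.+1) :
  let e : Cl K p.+1 q.+1 := vec (inl i) in
  let et : Cl K p.+1 q.+1 := vec (inr j) in
  let iota : Cl K p q -> Cl K p.+1 q.+1 := Cl_incl i j in
  let alpha : Cl K p q -> Cl K p q := parity in
  let Pp := 2^-1 *: (1 + et * e) in
  let Pm := 2^-1 *: (1 - et * e) in
  let peirce (a0p a1p a0m a1m : Cl K p q) :=
    Pp * iota a0p + Pp * e * iota a1p + Pm * iota a0m + Pm * e * iota a1m in
  let multivec (A00 A01 A10 A11 : Cl K p q) :=
    iota A00 + e * iota A01 + et * iota A10 + et * e * iota A11 in
  (forall a : Cl K p.+1 q.+1,
     exists! x : Cl K p q * Cl K p q * Cl K p q * Cl K p q,
       let: (a0p, a1p, a0m, a1m) := x in a = peirce a0p a1p a0m a1m)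
  /\ exists Phi : {lrmorphism Cl K p.+1 q.+1 -> 'M[Cl K p q]_2
                   | GRing.in_alg (Cl K p q) \; *:%R},
     [/\ bijective Phi,
         forall a0p a1p a0m a1m : Cl K p q,
           Phi (peirce a0p a1p a0m a1m) = mx2 a0p (alpha a1p) a1m (alpha a0m)
       & forall (a : Cl K p.+1 q.+1) (A00 A01 A10 A11 a0p a1p a0m a1m : Cl K p q),
           a = multivec A00 A01 A10 A11 -> a = peirce a0p a1p a0m a1m ->
         [/\ [/\ a0p = A00 + A11, a1p = A01 + A10,
                 a0m = A00 - A11 & a1m = A01 - A10],
             Phi a = mx2 (A00 + A11) (alpha (A01 + A10))
                         (A01 - A10) (alpha (A00 - A11))
           & [/\ A00 = 2^-1 *: (a0p + a0m), A01 = 2^-1 *: (a1p + a1m),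
                 A10 = 2^-1 *: (a1p - a1m) & A11 = 2^-1 *: (a0p - a0m)]]].
Proof.
move=> e et iota alpha Pp Pm peirce0 multivec.
have pE a b c d : peirce0 a b c d = peirce (Cl_incl i j) e et (a, b, c, d) by [].
have mE a b c d : multivec a b c d = multivector (Cl_incl i j) e et (a, b, c, d) by [].
have alphaK : involutive alpha := @parityK _ _ _.
have ee1 : e * e = 1 by apply: e_sq.
have etetN1 : et * et = -1 by apply: et_sq.
have eetN : e * et = - (et * e) by apply: e_et.
have eC x : e * Cl_incl i j x = Cl_incl i j (parity x) * e by apply: e_Cl_incl.
have etC x : et * Cl_incl i j x = Cl_incl i j (parity x) * et by apply: et_Cl_incl.
have mv_bij := multivector_bij K i j.
have multivector_inj := bij_inj mv_bij.
have peirce_inj := bij_inj (peirce_bij ee1 charK mv_bij).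
have m2pE := multivectorE (Cl_incl i j) et ee1 charK.
split=> [a|].
  have [[[[A B] D] E] ->] := multivector_surj i j a.
  exists (A + E, B + D, A - E, B - D); split; first exact: m2pE.
  by move=> [[[a' b'] c'] d']; rewrite pE m2pE => /peirce_inj.
(* Phi is the inverse of [of_matrix]; its morphism laws are checked after applying the injective
   [of_matrix]. *)
have [Phi of_matrixK PhiK] := of_matrix_bij alphaK ee1 etetN1 eetN eC charK mv_bij.
have Phi_lin : linear_for (GRing.in_alg (Cl K p q) \; *:%R) Phi.
  by move=> c a b; apply: (can_inj of_matrixK); rewrite of_matrix_linear !PhiK.
have Phi_mul : monoid_morphism Phi.
  have [psi1 psiM] := of_matrix_is_monoid_morphism alphaK ee1 etetN1 eetN eC etC charK.
  by split=> [|a b]; apply: (can_inj of_matrixK); rewrite PhiK ?psi1 // psiM !PhiK.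
pose PhiL := GRing.isLinear.Build _ _ _ _ Phi Phi_lin.
pose PhiM := GRing.isMonoidMorphism.Build _ _ Phi Phi_mul.
pose PhiH : {lrmorphism Cl K p.+1 q.+1 -> 'M[Cl K p q]_2 | GRing.in_alg (Cl K p q) \; *:%R} :=
  HB.pack Phi PhiL PhiM.
have PhiE a b c d : PhiH (peirce (Cl_incl i j) e et (a, b, c, d)) = mx2 a (alpha b) d (alpha c).
  by rewrite -(of_matrixE alphaK ee1 etetN1 eetN eC charK) /= of_matrixK.
exists PhiH; split=> [|a b c d|a A B D E a0p a1p a0m a1m ->].
- by exists (of_matrix (Cl_incl i j) parity e et).
- by rewrite pE PhiE.
(* [mpE] equates the two expressions of [a]; rewriting either one in the coordinates of the other
   and using injectivity gives both sets of formulas. *)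
rewrite mE pE => mpE; split.
- by move: mpE; rewrite m2pE => /peirce_inj[-> -> -> ->].
- by rewrite m2pE PhiE.
- by move: mpE; rewrite (peirceE (Cl_incl i j) et ee1) => /multivector_inj[-> -> -> ->].
Qed.
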